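(* Let $\Omega,\mathcal{C}$ be closed, convex sets in $\mathbb{R}^d$ with nonempty interior, and $\mathcal{C}\subseteq\Omega$. Assume $f:\Omega\to\mathbb{R}$ is convex on $\mathcal{C}$, and $L$-smooth with respect to a norm $\|\cdot\|$ on $\mathcal{C}\cap\mathrm{int}(\Omega)$, for $L>0$. Assume $\phi:\Omega\to\mathbb{R}$ is of Legendre type, and $\alpha$-strongly convex with respect to $\|\cdot\|$ on $\Omega$, for $\alpha>0$. Consider the mirror descent iterates $$\theta_{t+1}=\arg\min_{\theta\in\mathcal{C}}\Big(\eta_t\langle\nabla f(\theta_t),\theta\rangle+D_\phi(\theta,\theta_t)\Big),$$ initialized at $\theta_0\in\mathcal{C}\cap\mathrm{int}(\Omega)$, with step sizes $\eta_t\in(0,\alpha/L]$, $t=0,1,2,\dots$. Then for any reference point $z\in\mathcal{C}$ and any $T\ge1$, $$f(\theta_T)-f(z)\le\frac{1}{\sum_{t=0}^{T-1}\eta_t}\Big(D_\phi(z,\theta_0)-D_\phi(z,\theta_T)\Big).$$ In particular, for a constant step size $\eta_t=\eta$, $t=0,1,2,\dots$, $$f(\theta_T)-f(z)\le\frac{1}{\eta T}\Big(D_\phi(z,\theta_0)-D_\phi(z,\theta_T)\Big).$$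
   Context: $\mathrm{int}(\Omega)$ is the interior of $\Omega$ (relative interior when $\Omega$ is not full-dimensional) and $\partial\Omega$ its boundary. The Bregman divergence of a convex $\phi$, differentiable on $\mathrm{int}(\Omega)$, is $D_\phi(u,v)=\phi(u)-\phi(v)-\langle\nabla\phi(v),u-v\rangle$, for $u\in\Omega$, $v\in\mathrm{int}(\Omega)$. Writing the mirror descent update presupposes that the minimizer exists. $\phi$ is of Legendre type if it is essentially smooth and essentially strictly convex. Essentially smooth: $\mathrm{int}(\Omega)\ne\emptyset$, $\phi$ is differentiable on $\mathrm{int}(\Omega)$, and $\|\nabla\phi(x_k)\|_2\to\infty$ for any sequence $\{x_k\}\subset\mathrm{int}(\Omega)$ converging to a point of $\partial\Omega$. Essentially strictly convex: strictly convex on every convex subset of $\{x\in\Omega:\partial\phi(x)\neq\emptyset\}$, where $\partial\phi(x)$ is the subdifferential. $\phi$ is $\alpha$-strongly convex with respect to $\|\cdot\|$ if $\phi(y)\ge\phi(x)+\langle\nabla\phi(x),y-x\rangle+\frac{\alpha}{2}\|x-y\|^2$ for all $y\in\Omega$ and $x\in\mathrm{int}(\Omega)$. $f$ is $L$-smooth with respect to $\|\cdot\|$ on a set if it is differentiable there and $\|\nabla f(x)-\nabla f(y)\|_*\le L\|x-y\|$ for all $x,y$ in the set, where $\|\cdot\|_*$ is the dual norm. *)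

(* Defs.v *)
From HB Require Import structures.
From mathcomp Require Import all_boot all_order all_algebra.
From mathcomp Require Import all_classical all_reals all_analysis.

Set Implicit Arguments.
Unset Strict Implicit.
Unset Printing Implicit Defensive.

Import Order.TTheory GRing.Theory Num.Theory.
Import numFieldNormedType.Exports.

Local Open Scope classical_set_scope.
Local Open Scope ring_scope.
Local Open Scope convex_scope.

(* A function Omega -> R is represented by a total function on 'rV[R]_d.  Its
   values outside Omega are irrelevant below: differentiability and gradients
   are only used at points of the interior of Omega. *)

Section Euclidean.
Context {R : realType} {d : nat}.
Implicit Types (u v x : 'rV[R]_d) (f : 'rV[R]_d -> R) (N : 'rV[R]_d -> R).

Definition dotv u v : R := \sum_(i < d) u 0 i * v 0 i.

Definition norm2 v : R := Num.sqrt (dotv v v).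

Definition grad f x : 'rV[R]_d := \row_(i < d) 'D_(delta_mx 0 i) f x.

(* An arbitrary norm on R^d.  It need not be the canonical norm of 'rV[R]_d
   (the sup norm), which only serves to provide the topology of R^d. *)
Record is_norm N : Prop := IsNorm {
  is_norm_ge0 : forall x, 0 <= N x ;
  is_norm_eq0 : forall x, N x = 0 -> x = 0 ;
  is_normZ : forall (a : R) x, N (a *: x) = `|a| * N x ;
  is_normD : forall x y, N (x + y) <= N x + N y }.

Definition dual_norm N v : R := sup [set dotv v x | x in [set x | N x <= 1]].

End Euclidean.

Section Convexity.
Context {R : realType} {d : nat}.
Implicit Types (Omega C D : set 'rV[R]_d) (f phi : 'rV[R]_d -> R).
Implicit Types (N : 'rV[R]_d -> R).

Definition boundary Omega : set 'rV[R]_d := closure Omega `\` Omega°.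

Definition strictly_convex_function (D : set (convex_lmodType 'rV[R]_d))
    (f : convex_lmodType 'rV[R]_d -> R^o) : Prop :=
  forall t : {i01 R}, 0 < t%:num -> t%:num < 1 ->
    {in D &, forall x y, x != y -> f (x <| t |> y) < f x <| t |> f y}.

(* Subdifferential of phi extended by +oo outside Omega. *)
Definition subdifferential Omega phi (x : 'rV[R]_d) : set 'rV[R]_d :=
  [set g | forall y, Omega y -> phi x + dotv g (y - x) <= phi y].

Definition essentially_smooth Omega phi : Prop :=
  [/\ Omega° !=set0,
      forall x, Omega° x -> differentiable phi x &
      forall (u : nat -> 'rV[R]_d) (x : 'rV[R]_d),
        (forall k, Omega° (u k)) -> boundary Omega x -> u @ \oo --> x ->
        norm2 (grad phi (u k)) @[k --> \oo] --> +oo].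

Definition essentially_strictly_convex Omega phi : Prop :=
  forall D, convex_set D ->
    D `<=` [set x | Omega x /\ subdifferential Omega phi x !=set0] ->
    strictly_convex_function D phi.

Definition legendre_type Omega phi : Prop :=
  essentially_smooth Omega phi /\ essentially_strictly_convex Omega phi.

Definition strongly_convex Omega N (alpha : R) phi : Prop :=
  forall x y, Omega° x -> Omega y ->
    phi x + dotv (grad phi x) (y - x) + alpha / 2 * N (x - y) ^+ 2 <= phi y.

Definition smooth_on D N (L : R) f : Prop :=
  (forall x, D x -> differentiable f x) /\
  (forall x y, D x -> D y ->
     dual_norm N (grad f x - grad f y) <= L * N (x - y)).

End Convexity.

Section MirrorDescent.
Context {R : realType} {d : nat}.
Implicit Types (C : set 'rV[R]_d) (f phi F : 'rV[R]_d -> R).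

Definition bregman phi (u v : 'rV[R]_d) : R :=
  phi u - phi v - dotv (grad phi v) (u - v).

Definition is_argmin C F (x : 'rV[R]_d) : Prop :=
  C x /\ forall y, C y -> F x <= F y.

Definition mirror_descent C f phi (eta : nat -> R) (theta : nat -> 'rV[R]_d)
    : Prop :=
  forall t, is_argmin C
    (fun x => eta t * dotv (grad f (theta t)) x + bregman phi x (theta t))
    (theta t.+1).

End MirrorDescent.

(* Main.v *)
Require Import Defs.
From HB Require Import structures.
From mathcomp Require Import all_boot all_order all_algebra.
From mathcomp Require Import all_classical all_reals all_analysis.
From mathcomp Require Import ring lra.

Import Order.TTheory GRing.Theory Num.Theory.
Import numFieldNormedType.Exports.

Local Open Scope classical_set_scope.
Local Open Scope ring_scope.

(** Write [D] for the Bregman divergence, [x] for an iterate, [y] for the next one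
    and [eta] for the step size. Two facts about a single step carry the theorem.

    The step is well posed: [y] is again interior to Omega ([argmin_interior]).
    The minimized objective is a linear form plus [phi]. If its minimizer [y] were
    a boundary point, consider the points [u] of the segment from [y] to the
    interior point [x]. Minimality keeps the slope of [phi] at [u] along the
    segment bounded below, whereas testing the tangent inequality at [u] against
    the points [x + r e_i] and [x - r e_i] of a small cube around [x] bounds each
    coordinate of the gradient of [phi] at [u] in terms of that slope. So the
    gradient stays bounded as [u] tends to [y], against essential smoothness.

    A step pays for suboptimality with divergence ([mirror_step_descent]): for [z] in C,
    [eta * (f y - f z) <= D(z, x) - D(z, y)]. Smoothness ([smooth_on_le]) bounds
    [f y] by the linearization of [f] at [x] plus [L/2 N(y - x)^2], convexity bounds
    [f z] below by that linearization, first-order optimality of [y]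
    ([argmin_grad_ge]) compares the gradient of [f] with the difference of
    gradients of [phi], and the three-point identity turns the latter into
    [D(z, x) - D(z, y) - D(y, x)]. Strong convexity gives
    [D(y, x) >= alpha/2 N(y - x)^2], which absorbs the quadratic term because
    [eta L <= alpha].

    Taking [z = x] shows that [f] does not increase along the iterates; summing the
    inequality over the steps telescopes its right-hand side, and monotonicity
    replaces every value of [f] on the left by the last one. *)

(** * Dot product and sup norm *)

Section DotProduct.
Context {R : realType} {d : nat}.
Implicit Types (u v w x : 'rV[R]_d).

Lemma dotvDr u v w : dotv u (v + w) = dotv u v + dotv u w.
Proof. by rewrite /dotv -big_split; apply: eq_bigr => i _ /=; rewrite mxE mulrDr. Qed.

Lemma dotvZr u (a : R) v : dotv u (a *: v) = a * dotv u v.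
Proof. by rewrite /dotv mulr_sumr; apply: eq_bigr => i _; rewrite mxE mulrCA. Qed.

Lemma dotvZl (a : R) u v : dotv (a *: u) v = a * dotv u v.
Proof. by rewrite /dotv mulr_sumr; apply: eq_bigr => i _; rewrite mxE mulrA. Qed.

Lemma dotvBr u v w : dotv u (v - w) = dotv u v - dotv u w.
Proof. by rewrite dotvDr -scaleN1r dotvZr mulN1r. Qed.

Lemma dotvBl u v w : dotv (u - v) w = dotv u w - dotv v w.
Proof.
by rewrite /dotv -sumrB; apply: eq_bigr => i _; rewrite !mxE mulrBl.
Qed.

Lemma dotv_delta u (i : 'I_d) : dotv u (delta_mx 0 i) = u 0 i.
Proof.
rewrite /dotv (bigD1 i)//= big1 ?addr0 => [|j ji]; rewrite !mxE !eqxx.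
  by rewrite mulr1.
by rewrite (negbTE ji) mulr0.
Qed.

Lemma norm_coord_le x (i : 'I_d) : `|x 0 i| <= `|x|.
Proof.
rewrite [leRHS]/Num.norm /= mx_normrE.
by apply/bigmax_geP; right => /=; exists (0, i).
Qed.

Lemma norm_delta_le1 (i : 'I_d) : `|delta_mx 0 i : 'rV[R]_d| <= 1.
Proof.
rewrite [leLHS]/Num.norm /= mx_normrE; apply: bigmax_le => // j _.
by rewrite mxE; case: (_ && _); rewrite ?normr1 ?normr0.
Qed.

Lemma dotv_le_sum u x : dotv u x <= (\sum_(i < d) `|u 0 i|) * `|x|.
Proof.
rewrite mulr_suml; apply: ler_sum => i _.
by rewrite (le_trans (ler_norm _))// normrM ler_wpM2l// norm_coord_le.
Qed.

End DotProduct.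

(** * Arbitrary norms and their duals *)

Section Norms.
Context {R : realType} {d : nat} (N : 'rV[R]_d -> R) (N_norm : is_norm N).

Lemma is_norm0 : N 0 = 0.
Proof. by have := is_normZ N_norm 0 0; rewrite scale0r normr0 mul0r. Qed.

Lemma is_norm_distC x y : N (x - y) = N (y - x).
Proof. by rewrite -opprB -scaleN1r (is_normZ N_norm) normrN1 mul1r. Qed.

Lemma is_norm_le_norm x : N x <= (\sum_(i < d) N (delta_mx 0 i)) * `|x|.
Proof.
have N_sum (r : seq 'I_d) (F : 'I_d -> 'rV[R]_d) :
    N (\sum_(i <- r) F i) <= \sum_(i <- r) N (F i).
  elim: r => [|i r IHr]; first by rewrite !big_nil is_norm0.
  by rewrite !big_cons (le_trans (is_normD N_norm _ _))// lerD2l.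
rewrite {1}(row_sum_delta x) (le_trans (N_sum _ _))// mulr_suml.
apply: ler_sum => i _; rewrite (is_normZ N_norm) mulrC.
by rewrite ler_wpM2l ?norm_coord_le// (is_norm_ge0 N_norm).
Qed.

Lemma is_norm_continuous : continuous N.
Proof.
move=> x; set M := \sum_(i < d) N (delta_mx 0 i).
have M0 : 0 <= M by apply: sumr_ge0 => i _; exact: is_norm_ge0.
have lipN u v : N u - N v <= M * `|u - v|.
  rewrite lerBlDr; apply: le_trans (lerD (is_norm_le_norm _) (lexx _)).
  by rewrite (le_trans _ (is_normD N_norm _ _))// subrK.
have M1 : 0 < M + 1 by rewrite ltr_wpDl.
apply/(@cvgrPdist_lt _ _ _ (nbhs x)) => e e0; near=> y.
have xy : `|x - y| < e / (M + 1).
  near: y; apply/nbhs_ballP; exists (e / (M + 1)); first by rewrite /= divr_gt0.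
  by move=> y; rewrite -ball_normE.
apply: le_lt_trans (_ : (M + 1) * `|x - y| < e); last first.
  by rewrite mulrC -ltr_pdivlMr.
apply: le_trans (_ : M * `|x - y| <= _); last by rewrite ler_wpM2r// lerDl.
by rewrite ler_norml lerNl opprB lipN distrC lipN.
Unshelve. all: by end_near. Qed.

(** All norms on R^d are equivalent: by compactness, [N] has a positive minimum on
    the unit sphere of the sup norm. That sphere is empty when d = 0. *)
Lemma norm_le_is_norm : exists K : R, forall x, `|x| <= K * N x.
Proof.
pose S := [set x : 'rV[R]_d | `|x| = 1].
have normalize x : x != 0 -> S (`|x|^-1 *: x).
  by move=> x0; rewrite /S/= normrZ normfV normr_id mulVf// normr_eq0.
have [[x0 Sx0]|Sempty] := pselect (S !=set0); last first.
  exists 0 => x; rewrite mul0r; have [->|x0] := eqVneq x 0; first by rewrite normr0.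
  by case: Sempty; exists (`|x|^-1 *: x); exact: normalize.
have compactS : compact S.
  apply: bounded_closed_compact.
    by exists 1; split; [exact: real1 | move=> M M1 x /= ->; exact: ltW].
  rewrite (_ : S = (fun x : 'rV[R]_d => `|x|) @^-1` [set 1])//.
  apply: preimage_closed; first by move=> ? _; exact: norm_continuous.
  exact: closed_eq.
have [c] := @EVT_min_rV R d N S (ex_intro _ x0 Sx0) compactS
  (continuous_subspaceT is_norm_continuous).
rewrite inE => Sc minc.
have Nc0 : 0 < N c.
  rewrite lt_neqAle (is_norm_ge0 N_norm) andbT eq_sym; apply/eqP.
  move=> /(is_norm_eq0 N_norm) c0; move: Sc; rewrite /S/= c0 normr0 => /eqP.
  by rewrite eq_sym oner_eq0.
exists (N c)^-1 => x; have [->|xn0] := eqVneq x 0.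
  by rewrite normr0 is_norm0 mulr0.
rewrite mulrC ler_pdivlMr// mulrC -ler_pdivlMr ?normr_gt0// mulrC.
have := minc _ (mem_set (normalize _ xn0)).
by rewrite (is_normZ N_norm) normfV normr_id.
Qed.

(** The supremum defining [dual_norm] is an upper bound only because the unit ball
    of [N] is bounded, which is where the equivalence of norms enters. *)
Lemma dotv_le_dual_norm u x : dotv u x <= dual_norm N u * N x.
Proof.
have [Nx0|Nx0] := eqVneq (N x) 0.
  by rewrite (is_norm_eq0 N_norm Nx0) is_norm0 -(scale0r 0) dotvZr mul0r mulr0.
have Nx_gt0 : 0 < N x by rewrite lt_neqAle eq_sym Nx0 (is_norm_ge0 N_norm).
rewrite -ler_pdivrMr// mulrC -dotvZr; apply: ub_le_sup.
  have [K normK] := norm_le_is_norm.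
  exists ((\sum_(i < d) `|u 0 i|) * `|K|) => _ [y /= Ny1 <-].
  rewrite (le_trans (dotv_le_sum _ _))// ler_wpM2l ?sumr_ge0//.
  rewrite (le_trans (normK y))// (le_trans (ler_norm _))// normrM.
  by rewrite ler_piMr// ger0_norm// (is_norm_ge0 N_norm).
exists ((N x)^-1 *: x) => //=.
by rewrite (is_normZ N_norm) ger0_norm ?invr_ge0 ?(is_norm_ge0 N_norm)// mulVf.
Qed.

End Norms.

(** * Gradients and directional growth *)

Section Gradient.
Context {R : realType} {d : nat}.
Implicit Types (f : 'rV[R]_d -> R) (x v : 'rV[R]_d).

Lemma derive_grad f x v : differentiable f x -> 'D_v f x = dotv (grad f x) v.
Proof.
move=> df; rewrite deriveE// {1}(row_sum_delta v) linear_sum /dotv.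
by apply: eq_bigr => i _; rewrite linearZ/= mxE deriveE// mulrC.
Qed.

Lemma is_derive_line f x v (s : R) : differentiable f (x + s *: v) ->
  is_derive s 1 (fun r : R => f (x + r *: v)) (dotv (grad f (x + s *: v)) v).
Proof.
move=> df.
have quotientE : (fun h : R => h^-1 *: (((fun r : R => f (x + r *: v)) \o shift s)
      (h *: (1 : R)) - f (x + s *: v))) =
    (fun h => h^-1 *: ((f \o shift (x + s *: v)) (h *: v) - f (x + s *: v))).
  by apply/funext => h /=; rewrite [h%:A]mulr1 scalerDl addrCA addrA.
apply: DeriveDef.
  by rewrite /derivable quotientE; exact: diff_derivable.
by rewrite /derive quotientE -derive_grad.
Qed.

(** The derivative is the limit of the difference quotients taken from the right
    alone, so one-sided information suffices; this is what is available at a point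
    of a convex set, where only the directions into the set can be tested. *)
Lemma is_derive_right_le (g : R -> R) (l c : R) : is_derive (0 : R) (1 : R) g l ->
  (forall s, 0 < s <= 1 -> g s - g 0 <= s * c) -> l <= c.
Proof.
move=> [dg <-] gle; rewrite ['D_1 g 0]cvg_at_rightE; last exact: dg.
apply: limr_le.
  rewrite -(cvg_at_rightE (fun h : R => h^-1 *: ((g \o shift 0) _ - g 0))) //.
  apply: cvg_trans dg; apply: cvg_app.
  by move=> A [e egt0 Ae]; exists e => // x xe xgt0; apply: Ae => //; exact: lt0r_neq0.
near=> h.
have h01 : 0 < h <= 1.
  by apply/andP; split; near: h; [exact: nbhs_right_gt | exact: nbhs_right_le].
rewrite /= addr0 [h%:A]mulr1 [_ *: _]mulrC ler_pdivrMr; last by case/andP: h01.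
by rewrite mulrC; exact: gle.
Unshelve. all: by end_near. Qed.

Lemma grad_dir_le f x v (c : R) : differentiable f x ->
  (forall s : R, 0 < s <= 1 -> f (x + s *: v) - f x <= s * c) ->
  dotv (grad f x) v <= c.
Proof.
move=> df fle.
apply: (@is_derive_right_le (fun r => f (x + r *: v))).
  by rewrite -[in X in grad f X](addr0 x) -(scale0r v); apply: is_derive_line;
     rewrite scale0r addr0.
by move=> s s01 /=; rewrite scale0r addr0; exact: fle.
Qed.

Lemma grad_dir_ge f x v (c : R) : differentiable f x ->
  (forall s : R, 0 < s <= 1 -> s * c <= f (x + s *: v) - f x) ->
  c <= dotv (grad f x) v.
Proof.
move=> df fge; rewrite -lerN2.
apply: (@is_derive_right_le (- (fun r => f (x + r *: v)))).
  by rewrite -[in X in grad f X](addr0 x) -(scale0r v); apply: is_deriveN;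
     apply: is_derive_line; rewrite scale0r addr0.
move=> s s01; rewrite !fctE scale0r addr0 mulrN -opprD lerN2.
exact: fge.
Qed.

End Gradient.

(** * Segments, interiors, tangents and the descent lemma *)

Section Convexity.
Context {R : realType} {d : nat}.
Implicit Types (A Omega C D : set 'rV[R]_d) (f phi : 'rV[R]_d -> R).
Implicit Types (x y z a g : 'rV[R]_d).

Let conv_segment (x y : 'rV[R]_d) (t : {i01 R}) :
  (conv t (y : convex_lmodType _) (x : convex_lmodType _) : 'rV[R]_d) =
  x + t%:num *: (y - x).
Proof. by rewrite /conv/= scalerBl scale1r scalerBr addrC addrAC addrA. Qed.

Lemma convex_set_segmentP A : convex_set A <->
  forall x y (s : R), 0 <= s <= 1 -> A x -> A y -> A (x + s *: (y - x)).
Proof.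
split=> [cA x y s /andP[s0 s1] Ax Ay|cA y x t /[!inE] Ay Ax].
  have /set_mem := cA y x (Itv01 s0 s1) (mem_set Ay) (mem_set Ax).
  by rewrite conv_segment.
by rewrite conv_segment; apply: cA; rewrite ?ge0 ?le1.
Qed.

Lemma convex_function_segment D f x y (s : R) : convex_function D f ->
  D x -> D y -> 0 <= s <= 1 -> f (x + s *: (y - x)) <= f x + s * (f y - f x).
Proof.
move=> cf Dx Dy /andP[s0 s1].
have := cf (Itv01 s0 s1) y x (mem_set Dy) (mem_set Dx).
rewrite conv_segment convRE /= => le_s.
by have -> : f x + s * (f y - f x) = s * f y + (1 - s) * f x by ring.
Qed.

(** A ball of radius [e] around [a] inside [A] contracts, by the homothety of centre
    [x] and ratio [s], to a ball of radius [s * e] inside [A]. *)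
Lemma interior_segment A x a (s : R) : convex_set A -> A x -> A° a ->
  0 < s <= 1 -> A° (x + s *: (a - x)).
Proof.
move=> /convex_set_segmentP cA Ax /nbhs_ballP[e /= e0 aeA] /andP[s0 s1].
apply/nbhs_ballP; exists (s * e); first by rewrite /= mulr_gt0.
move=> y; rewrite -ball_normE /= => xsy.
(* the preimage of y under the homothety *)
pose w := a + s^-1 *: (y - (x + s *: (a - x))).
have Aw : A w.
  apply: aeA; rewrite -ball_normE /= /w opprD addNKr normrN normrZ normfV.
  by rewrite (gtr0_norm s0) mulrC ltr_pdivrMr// mulrC distrC.
have -> : y = x + s *: (w - x).
  rewrite /w addrAC scalerDr scalerA divff ?gt_eqF// scale1r.
  by rewrite addrA addrC subrK.
by apply: cA => //; rewrite (ltW s0) s1.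
Qed.

Lemma convex_set_interior A : convex_set A -> convex_set A°.
Proof.
move=> cA; apply/convex_set_segmentP => x y s /andP[s0 s1] Ax Ay.
have [->|sn0] := eqVneq s 0; first by rewrite scale0r addr0.
apply: interior_segment => //; first exact: interior_subset.
by rewrite lt_neqAle eq_sym sn0 s0.
Qed.

Lemma convex_setI A D : convex_set A -> convex_set D -> convex_set (A `&` D).
Proof.
move=> /convex_set_segmentP cA /convex_set_segmentP cD.
by apply/convex_set_segmentP => x y s s01 [? ?] [? ?]; split; [exact: cA | exact: cD].
Qed.

Lemma convex_grad_le D f x y : convex_function D f -> differentiable f x ->
  D x -> D y -> f x + dotv (grad f x) (y - x) <= f y.
Proof.
move=> cf df Dx Dy; rewrite addrC -lerBrDr.
apply: grad_dir_le => // s /andP[s0 s1]; rewrite lerBlDl.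
by apply: (convex_function_segment _ _ _ _ _ cf) => //; rewrite (ltW s0) s1.
Qed.

(** The function [f (x + s (y - x)) - s c - s^2 q], with [c] the slope of [f] at [x]
    along [y - x] and [q = L/2 N(y - x)^2], has derivative at most 0 on [0, 1], since
    the slope of [f] changes by at most [L s N(y - x)^2]; hence its value at 1 is at
    most its value at 0. *)
Lemma smooth_on_le D (N : 'rV[R]_d -> R) (L : R) f x y :
  is_norm N -> convex_set D -> smooth_on D N L f -> D x -> D y ->
  f y <= f x + dotv (grad f x) (y - x) + L / 2 * N (y - x) ^+ 2.
Proof.
move=> N_norm /convex_set_segmentP cD [df lipf] Dx Dy.
set v := y - x; set c := dotv (grad f x) v; set q := L / 2 * N v ^+ 2.
pose p : {poly R} := - (c *: 'X + q *: 'X ^+ 2).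
pose h : R -> R := (fun r => f (x + r *: v)) + horner p.
have Dseg (s : R) : 0 <= s <= 1 -> D (x + s *: v) by move=> s01; exact: cD.
have dh (s : R) : 0 <= s <= 1 ->
    is_derive s (1 : R) h (dotv (grad f (x + s *: v)) v + p^`().[s]).
  by move=> s01; apply: is_deriveD; apply: is_derive_line; exact/df/Dseg.
have h_derivable (s : R) : s \in `]0, 1[%R -> derivable h s 1.
  by rewrite in_itv/= => /andP[s0 s1]; have [] := dh s; rewrite ?(ltW s0) ?(ltW s1).
have h_decr (s : R) : s \in `]0, 1[%R -> h^`()%classic s <= 0.
  rewrite in_itv/= => /andP[s0 s1].
  have s01 : 0 <= s <= 1 by rewrite (ltW s0) (ltW s1).
  rewrite derive1E; have [_ ->] := dh s s01.
  have lip : dotv (grad f (x + s *: v) - grad f x) v <= L * s * N v ^+ 2.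
    rewrite (le_trans (dotv_le_dual_norm _ N_norm _ _))// expr2 mulrA.
    rewrite ler_wpM2r ?(is_norm_ge0 N_norm)//.
    rewrite (le_trans (lipf _ _ (Dseg _ s01) Dx))//.
    by rewrite [x + _]addrC addrK (is_normZ N_norm) gtr0_norm// mulrA.
  move: lip; rewrite dotvBl -/c /p derivN derivD !derivZ derivX derivXn.
  rewrite !hornerE /= => lip.
  rewrite /q; lra.
have h_cont : {within `[0, 1], continuous h}.
  apply: derivable_within_continuous => s; rewrite in_itv/= => s01.
  by have [] := dh s s01.
have : h 1 <= h 0.
  by apply: (ler0_derive1_le_cc h_derivable h_decr h_cont);
     rewrite ?bound_itvE ?ler01.
rewrite /h /p !fctE !hornerE scale1r scale0r addr0 /v subrKC /= !mulr1 !mulr0.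
by rewrite -/v -/c; lra.
Qed.

(** * Minimizers of a linear form plus a convex function *)

(** A minimizer on the boundary would make the gradients of [phi] bounded along the
    segment joining it to the interior point [a], contradicting the blow-up of
    gradients in essential smoothness. *)
Lemma argmin_interior Omega C phi g x a :
  convex_set Omega -> convex_set C -> C `<=` Omega ->
  convex_function Omega phi -> essentially_smooth Omega phi ->
  C a -> Omega° a -> is_argmin C (fun y => dotv g y + phi y) x -> Omega° x.
Proof.
move=> cOmega /convex_set_segmentP cC subC cphi [_ dphi blowup] Ca Oa [Cx minx].
apply: contrapT => NOx.
pose u k : 'rV[R]_d := x + (harmonic k : R) *: (a - x).
have harmonic01 k : 0 < (harmonic k : R) <= 1.
  by rewrite /harmonic/= invr_gt0 ltr0Sn invf_le1 ?ltr0Sn// ler1n.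
have Ou k : Omega° (u k) by apply: interior_segment => //; exact: subC.
have bx : boundary Omega x by split=> //; exact/subset_closure/subC.
have ux : u @ \oo --> x.
  rewrite -[X in _ --> X]addr0 -(scale0r (a - x)).
  by apply: cvgD; [exact: cvg_cst | apply: cvgZr_tmp; exact: cvg_harmonic].
have /cvgryPgt grad_oo := blowup u x Ou bx ux.
move: (Oa) => /nbhs_ballP[e /= e0 aeO].
pose r := e / 2; have r0 : 0 < r by rewrite divr_gt0.
have Or (t : R) i : `|t| <= 1 -> Omega (a + (t * r) *: delta_mx 0 i).
  move=> t1; apply: aeO; rewrite -ball_normE /= opprD addNKr normrN normrZ normrM.
  rewrite (gtr0_norm r0); apply: (@le_lt_trans _ _ r); last by rewrite /r; lra.
  rewrite -[leRHS]mulr1 -[in leRHS](mul1r r).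
  by apply: ler_pM; rewrite ?mulr_ge0 ?(ltW r0) ?ler_wpM2r ?norm_delta_le1// ltW.
(* B bounds phi on the test points a + r e_i and a - r e_i: being finitely many,
   they have a common bound. *)
pose F (i : 'I_d) := `|phi (a + (1 * r) *: delta_mx 0 i)| +
  `|phi (a + (-1 * r) *: delta_mx 0 i)|.
pose B := \sum_i F i.
have FB i : F i <= B.
  by rewrite /B (bigD1 i)//= lerDl sumr_ge0// => j _; rewrite addr_ge0.
pose G := dotv g (a - x).
pose K := (B + `|phi x| + 2 * `|G|) / r.
have coord_le k i : `|grad phi (u k) 0 i| <= K.
  have /andP[s0 s1] := harmonic01 k.
  set s : R := harmonic k in s0 s1; set p := grad phi (u k).
  have uE : u k = x + s *: (a - x) by [].
  have Cu : C (u k) by apply: cC => //; rewrite (ltW s0) s1.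
  have supp y : Omega y -> phi (u k) + dotv p (y - u k) <= phi y.
    by apply: convex_grad_le => //; [exact: dphi | exact: interior_subset].
  have min_u : phi x <= phi (u k) + s * G.
    have := minx _ Cu; rewrite uE dotvDr dotvZr -/G; lra.
  (* the tangent at u k tested against x, then minimality of x *)
  have pG : - G <= dotv p (a - x).
    have xu : x - u k = (- s) *: (a - x) by rewrite uE opprD addNKr scaleNr.
    have := supp x (subC _ Cx); rewrite xu dotvZr => suppx.
    rewrite -(ler_pM2l s0); lra.
  have sG : s * G <= `|G|.
    by rewrite (le_trans (ler_norm _))// normrM ler_piMl// gtr0_norm.
  have s'pG : - `|G| <= (1 - s) * dotv p (a - x).
    have G1 : (1 - s) * G <= `|G|.
      by rewrite (le_trans (ler_norm _))// normrM ler_piMl// ger0_norm; lra.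
    apply: (@le_trans _ _ ((1 - s) * - G)); first by rewrite mulrN lerN2.
    by rewrite ler_wpM2l// subr_ge0.
  have phix := ler_norm (- phi x); rewrite normrN in phix.
  (* the tangent at u k tested against a + r e_i and a - r e_i, for t = 1, -1 *)
  have test (t : R) : `|t| <= 1 -> phi (a + (t * r) *: delta_mx 0 i) <= B ->
      t * p 0 i <= K.
    move=> t1 phiB; rewrite /K ler_pdivlMr//.
    have := supp _ (Or t i t1).
    have -> : a + (t * r) *: delta_mx 0 i - u k =
        (t * r) *: delta_mx 0 i + (1 - s) *: (a - x).
      by rewrite uE scalerBl scale1r opprD !addrA [a + _]addrC.
    rewrite dotvDr !dotvZr dotv_delta; lra.
  have := FB i; rewrite /F => FiB.
  rewrite ler_norml lerNl -mulN1r -[leLHS]mul1r; apply/andP; split.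
    rewrite mul1r; apply: test; rewrite ?normrN1//.
    have := ler_norm (phi (a + (-1 * r) *: delta_mx 0 i)).
    have := normr_ge0 (phi (a + (1 * r) *: delta_mx 0 i)); lra.
  rewrite -[leLHS]mul1r; apply: test; rewrite ?normr1//.
  have := ler_norm (phi (a + (1 * r) *: delta_mx 0 i)).
  have := normr_ge0 (phi (a + (-1 * r) *: delta_mx 0 i)); lra.
have [k _ /(_ k (leqnn k))] := grad_oo (Num.sqrt (\sum_(i < d) K ^+ 2)).
apply/negP; rewrite -leNgt; apply: ler_wsqrtr; apply: ler_sum => i _.
by rewrite -expr2 -real_normK ?num_real// lerXn2r ?nnegrE// (le_trans _ (coord_le k i)).
Qed.

Lemma argmin_grad_ge C phi g x z : convex_set C ->
  is_argmin C (fun y => dotv g y + phi y) x -> differentiable phi x -> C z ->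
  - dotv g (z - x) <= dotv (grad phi x) (z - x).
Proof.
move=> /convex_set_segmentP cC [Cx minx] dphi Cz.
apply: grad_dir_ge => // s /andP[s0 s1].
have Cs : C (x + s *: (z - x)) by apply: cC; rewrite ?(ltW s0).
have := minx _ Cs; rewrite dotvDr dotvZr; lra.
Qed.

(** The divergence to a fixed [y] differs from [phi] by an affine function, so a
    mirror descent step minimizes a linear form plus [phi]. *)
Lemma bregman_argmin C phi g x y : is_argmin C (fun u => dotv g u + bregman phi u y) x ->
  is_argmin C (fun u => dotv (g - grad phi y) u + phi u) x.
Proof.
move=> [Cx minx]; split=> // u Cu.
by have := minx _ Cu; rewrite /bregman !dotvBl !dotvBr; lra.
Qed.

Lemma bregman_three_point phi x y z :
  dotv (grad phi x - grad phi y) (z - x) =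
  bregman phi z y - bregman phi z x - bregman phi x y.
Proof. by rewrite /bregman dotvBl !dotvBr; ring. Qed.

End Convexity.

(** * One step of mirror descent, and the convergence rate *)

Section MirrorDescentStep.
Context {R : realType} {d : nat}.
Variables (Omega C : set 'rV[R]_d) (N f phi : 'rV[R]_d -> R) (L alpha : R).
Hypotheses (Omega_convex : convex_set Omega) (C_convex : convex_set C).
Hypotheses (C_sub : C `<=` Omega) (N_norm : is_norm N).
Hypotheses (f_convex : convex_function C f).
Hypotheses (L_gt0 : 0 < L) (f_smooth : smooth_on (C `&` Omega°) N L f).
Hypotheses (phi_convex : convex_function Omega phi).
Hypotheses (phi_smooth : essentially_smooth Omega phi) (alpha_gt0 : 0 < alpha).
Hypotheses (phi_strong : strongly_convex Omega N alpha phi).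

Lemma bregman_strong x y : Omega° x -> Omega y ->
  alpha / 2 * N (y - x) ^+ 2 <= bregman phi y x.
Proof.
move=> Ox Oy; have := phi_strong _ _ Ox Oy.
by rewrite /bregman (is_norm_distC N N_norm); lra.
Qed.

Variables (eta : R) (x y : 'rV[R]_d).
Hypothesis (eta_bound : 0 < eta <= alpha / L).
Hypothesis (x_in : (C `&` Omega°) x).
Hypothesis (y_argmin :
  is_argmin C (fun u => eta * dotv (grad f x) u + bregman phi u x) y).

Let y_argmin_linear : is_argmin C
  (fun u => dotv (eta *: grad f x - grad phi x) u + phi u) y.
Proof.
apply: bregman_argmin; have [Cy miny] := y_argmin; split=> // u Cu.
by rewrite !dotvZl; exact: miny.
Qed.

Lemma mirror_step_interior : (C `&` Omega°) y.
Proof.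
have [Cx Ox] := x_in; split; first by case: y_argmin.
exact: (argmin_interior _ _ _ _ _ _ Omega_convex C_convex C_sub phi_convex
  phi_smooth Cx Ox y_argmin_linear).
Qed.

(** The choice of step size enters as [eta * L/2 <= alpha/2]: the quadratic error of
    the linearization of [f] is then paid for by the divergence of [y] from [x]. *)
Lemma mirror_step_descent z : C z ->
  eta * (f y - f z) <= bregman phi z x - bregman phi z y.
Proof.
move=> Cz; have [Cx Ox] := x_in; have [Cy Oy] := mirror_step_interior.
have /andP[eta0 etaL] := eta_bound.
have [_ dphi _] := phi_smooth; have [df _] := f_smooth.
have D_convex := convex_setI _ _ C_convex (convex_set_interior _ Omega_convex).
have descent := smooth_on_le _ _ _ _ _ _ N_norm D_convex f_smooth x_in
  mirror_step_interior.
have tangent := convex_grad_le _ _ _ _ f_convex (df _ x_in) Cx Cz.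
have optimal := argmin_grad_ge _ _ _ _ _ C_convex y_argmin_linear (dphi _ Oy) Cz.
have three := bregman_three_point phi y x z.
have strong := bregman_strong x y Ox (C_sub _ Cy).
have step : eta * (L / 2 * N (y - x) ^+ 2) <= alpha / 2 * N (y - x) ^+ 2.
  rewrite mulrA ler_wpM2r ?sqr_ge0// mulrA ler_pM2r ?invr_gt0//.
  by rewrite -ler_pdivlMr.
have fyz : f y - f z <= dotv (grad f x) (y - z) + L / 2 * N (y - x) ^+ 2.
  by move: descent tangent; rewrite !dotvBr; lra.
have := ler_wpM2l (ltW eta0) fyz; rewrite mulrDr => etafyz.
move: optimal three; rewrite !dotvBl dotvZl => optimal three.
have -> : bregman phi z x - bregman phi z y =
  dotv (grad phi y) (z - y) - dotv (grad phi x) (z - y) + bregman phi y x by lra.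
have : eta * dotv (grad f x) (y - z) = - (eta * dotv (grad f x) (z - y)).
  by rewrite !dotvBr; ring.
lra.
Qed.

End MirrorDescentStep.

Theorem theorem2 (R : realType) (d : nat)
    (Omega C : set 'rV[R]_d)
    (Omega_closed : closed Omega) (Omega_convex : convex_set Omega)
    (Omega_int : Omega° !=set0)
    (C_closed : closed C) (C_convex : convex_set C) (C_int : C° !=set0)
    (C_sub : C `<=` Omega)
    (N : 'rV[R]_d -> R) (N_norm : is_norm N)
    (f : 'rV[R]_d -> R) (f_convex : convex_function C f)
    (L : R) (L_gt0 : 0 < L) (f_smooth : smooth_on (C `&` Omega°) N L f)
    (phi : 'rV[R]_d -> R) (phi_convex : convex_function Omega phi)
    (phi_legendre : legendre_type Omega phi)
    (alpha : R) (alpha_gt0 : 0 < alpha)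
    (phi_strong : strongly_convex Omega N alpha phi)
    (eta : nat -> R) (eta_bound : forall t, 0 < eta t <= alpha / L)
    (theta : nat -> 'rV[R]_d) (theta0_in : (C `&` Omega°) (theta 0%N))
    (theta_md : mirror_descent C f phi eta theta) :
  (forall (z : 'rV[R]_d) (T : nat), C z -> (1 <= T)%N ->
     f (theta T) - f z <=
       1 / (\sum_(0 <= t < T) eta t) *
       (bregman phi z (theta 0%N) - bregman phi z (theta T))) /\
  (forall eta0 : R, (forall t, eta t = eta0) ->
   forall (z : 'rV[R]_d) (T : nat), C z -> (1 <= T)%N ->
     f (theta T) - f z <=
       1 / (eta0 * T%:R) *
       (bregman phi z (theta 0%N) - bregman phi z (theta T))).
Proof.
have [phi_smooth _] := phi_legendre.
have theta_in t : (C `&` Omega°) (theta t).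
  elim: t => [//|t IHt].
  exact: (mirror_step_interior _ _ _ _ Omega_convex C_convex C_sub phi_convex
    phi_smooth _ _ _ IHt (theta_md t)).
have step t z : C z -> eta t * (f (theta t.+1) - f z) <=
    bregman phi z (theta t) - bregman phi z (theta t.+1).
  exact: (mirror_step_descent _ _ _ _ _ _ _ Omega_convex C_convex C_sub N_norm
    f_convex L_gt0 f_smooth phi_convex phi_smooth phi_strong _ _ _
    (eta_bound t) (theta_in t) (theta_md t)).
have eta_gt0 t : 0 < eta t by case/andP: (eta_bound t).
(* the one-step inequality at the reference point theta t itself *)
have f_decr t : f (theta t.+1) <= f (theta t).
  have [Ct Ot] := theta_in t; have [Ct1 Ot1] := theta_in t.+1.
  have := step t (theta t) Ct.
  have : 0 <= bregman phi (theta t) (theta t.+1).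
    apply: le_trans (bregman_strong _ _ _ _ N_norm phi_strong _ _ Ot1 (C_sub _ Ct)).
    by rewrite mulr_ge0 ?sqr_ge0// divr_ge0// ltW.
  have -> : bregman phi (theta t) (theta t) = 0.
    by rewrite /bregman dotvBr !subrr.
  move=> b0 le_b; rewrite -subr_le0 -(pmulr_rle0 _ (eta_gt0 t)); lra.
have telescope z T : C z -> (\sum_(0 <= t < T) eta t) * (f (theta T) - f z) <=
    bregman phi z (theta 0%N) - bregman phi z (theta T).
  move=> Cz; elim: T => [|T IHT]; first by rewrite big_geq// mul0r subrr.
  rewrite big_nat_recr//= mulrDl.
  have sum_ge0 : 0 <= \sum_(0 <= t < T) eta t.
    by apply: sumr_ge0 => t _; exact: ltW.
  have := ler_wpM2l sum_ge0 (lerB (f_decr T) (lexx (f z))).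
  have := step T z Cz; lra.
have general z T : C z -> (1 <= T)%N -> f (theta T) - f z <=
    1 / (\sum_(0 <= t < T) eta t) *
    (bregman phi z (theta 0%N) - bregman phi z (theta T)).
  case: T => // T Cz _; rewrite div1r mulrC ler_pdivlMr.
    by rewrite mulrC; exact: telescope.
  rewrite big_nat_recl//= ltr_pwDl// sumr_ge0// => t _; exact: ltW.
split=> // eta0 etaE z T Cz T1.
have := general z T Cz T1.
by under eq_bigr do rewrite etaE; rewrite sumr_const_nat subn0 mulr_natr.
Qed.
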